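(* Let $A:X\to Y$ be a compact linear operator with singular system $(\sigma_n,u_n,v_n)_{n\in\mathbb N}$, let $U$ be the random ground truth and $\nu$ the independent, zero-mean noise (as specified in the context), with variance coefficients $\Pi_n=\mathbb E(\langle U,u_n\rangle^2)$ and $\Delta_n=\mathbb E(\langle\nu,v_n\rangle^2)$. Assume that for every $n\in\mathbb N$ at least one of $\Pi_n>0$, $\Delta_n>0$ holds. Then among all real sequences $g=(g_n)_{n\in\mathbb N}$ the unique minimizer of $$g\longmapsto \mathbb E_{U,\nu}\big(\|U-R(AU+\nu;g)\|^2\big)$$ is $$\overline g_n=\frac{\sigma_n\Pi_n}{\sigma_n^2\Pi_n+\Delta_n},\qquad n\in\mathbb N,$$ and $$\min_g\ \mathbb E_{U,\nu}\big(\|U-R(AU+\nu;g)\|^2\big)-\mathbb E_U\big(\|U_0\|^2\big)=\sum_{n}\frac{\Delta_n\Pi_n}{\sigma_n^2\Pi_n+\Delta_n}.$$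
   Context: $X$ and $Y$ are infinite-dimensional real Hilbert spaces, and $A:X\to Y$ is a compact linear operator with infinite-dimensional range and singular value expansion $Au=\sum_{n=1}^\infty\sigma_n\langle u,u_n\rangle v_n$. Here $\sigma_n>0$ are the singular values, assumed strictly decreasing (each of multiplicity one), $\{u_n\}$ is an orthonormal basis of $\mathcal N(A)^\perp$ and $\{v_n\}$ is an orthonormal basis of $\overline{\mathcal R(A)}$. The ground truth $U$ is an $X$-valued random variable with $\mathbb E(\|U\|^2)<\infty$, and $U_0$ is its orthogonal projection onto the nullspace $\mathcal N(A)$. The noise $\nu$ is independent of $U$ and has zero mean; it enters only through its coefficients $\langle\nu,v_n\rangle$, which are real random variables with mean zero and finite second moment. (White noise is allowed, so $\nu$ need not take values in $Y$.) It is assumed that $\sup_n\Delta_n<\infty$. For a real sequence $g=(g_n)$ the spectral reconstruction operator is $R(f;g)=\sum_{n=1}^\infty g_n\langle f,v_n\rangle u_n$. In particular $R(AU+\nu;g)=\sum_n g_n(\sigma_n\langle U,u_n\rangle+\langle\nu,v_n\rangle)u_n$. The squared norm $\|U-R(AU+\nu;g)\|^2$ is understood as $\|U_0\|^2+\sum_n\big((1-\sigma_ng_n)\langle U,u_n\rangle-g_n\langle\nu,v_n\rangle\big)^2\in[0,\infty]$. *)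

(* Defs.v *)
From HB Require Import structures.
From mathcomp Require Import all_boot all_order all_algebra.
From mathcomp Require Import all_classical all_reals all_analysis.

Set Implicit Arguments.
Unset Strict Implicit.
Unset Printing Implicit Defensive.

Import Order.TTheory GRing.Theory Num.Theory.
Import numFieldNormedType.Exports.

Local Open Scope classical_set_scope.
Local Open Scope ring_scope.

(* A real Hilbert space is a complete normed space whose norm is induced by an
   inner product; over the reals the conjugation of a dot form is [idfun]. *)
HB.mixin Record CompleteNormedModule_isHilbert (R : realType) H
    of CompleteNormedModule R H := {
  inner : {dot H for @idfun R} ;
  inner_norm : forall x : H, inner x x = `|x| ^+ 2
}.

#[short(type="hilbertType")]
HB.structure Definition Hilbert (R : realType) :=
  {H of CompleteNormedModule_isHilbert R H & CompleteNormedModule R H}.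

Notation "'<|' x , y '|>'" := (inner x y)
  (at level 0, x at level 99, y at level 99, format "<| x ,  y |>").

(* For a subspace [S]; a finite-dimensional one bounds the length of free
   families. *)
Definition infinite_dimensional (R : realType) (V : lmodType R) (S : set V) :=
  forall n : nat, exists2 f : 'I_n -> V, (forall i, S (f i)) &
    forall c : 'I_n -> R, \sum_i c i *: f i = 0 -> forall i, c i = 0.

Definition kernel_of (R : realType) (X Y : lmodType R) (A : {linear X -> Y}) :
    set X :=
  [set x | A x = 0].

Definition orthogonal_compl (R : realType) (H : hilbertType R) (S : set H) :
    set H :=
  [set x | forall y, S y -> <|x, y|> = 0].

(* The value is the genuine projection whenever it exists, in particular for
   closed subspaces, and the junk value 0 otherwise. *)
Definition orthogonal_proj (R : realType) (H : hilbertType R) (S : set H)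
    (x : H) : H :=
  xget 0 [set p | S p /\ orthogonal_compl S (x - p)].

Definition linear_span (R : realType) (V : lmodType R) (e : nat -> V) :
    set V :=
  [set x | exists n (c : nat -> R), x = \sum_(i < n) c i *: e i].

Definition orthonormal_basis (R : realType) (H : hilbertType R) (e : nat -> H)
    (S : set H) :=
  (forall m n, <|e m, e n|> = (m == n)%:R) /\ closure (linear_span e) = S.

Definition compact_operator (R : realType) (X Y : hilbertType R)
    (A : {linear X -> Y}) :=
  forall B : set X, bounded_set B -> precompact (A @` B).

Definition singular_system (R : realType) (X Y : hilbertType R)
    (A : {linear X -> Y}) (sigma : nat -> R) (u : nat -> X) (v : nat -> Y) :=
  [/\ forall n, 0 < sigma n,
      forall m n, (m < n)%N -> sigma n < sigma m,
      orthonormal_basis u (orthogonal_compl (kernel_of A)),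
      orthonormal_basis v (closure (range A)) &
      forall x, series (fun n => (sigma n * <|x, u n|>) *: v n) @ \oo --> A x].

(* [X] with its Borel sigma-algebra. *)
Definition borel (R : realType) (X : normedModType R) :=
  g_sigma_algebraType (@open X).

Definition independent_systems (R : realType) d (T : measurableType d)
    (P : probability T R) (F G : set (set T)) :=
  forall A B, F A -> G B -> P (A `&` B) = (P A * P B)%E.

Definition sigma_gen d (T : measurableType d) d' (T' : measurableType d')
    (Z : T -> T') : set (set T) :=
  preimage_set_system setT Z measurable.

Definition sigma_gen_seq d (T : measurableType d) d' (T' : measurableType d')
    (Z : nat -> T -> T') : set (set T) :=
  <<s \bigcup_n sigma_gen (Z n) >>.

Definition second_moment (R : realType) d (T : measurableType d)
    (P : probability T R) (Z : T -> R) : \bar R :=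
  'E_P[fun w => (Z w ^+ 2)%R]%E.

(* [|U - R(AU + nu; g)|^2] in [0, +oo], where [nu n] stands for the coefficient
   [<nu, v_n>]: the noise need not take values in [Y], and the reconstruction
   need not converge in [X]. The [n]-th term is the coefficient on [u n] of
   [U - R(AU + nu; g)], that is
   [<U, u_n> - g_n (sigma_n <U, u_n> + <nu, v_n>)]. *)
Definition squared_error (R : realType) (X Y : hilbertType R)
    (A : {linear X -> Y}) (sigma : nat -> R) (u : nat -> X) (T : Type)
    (U : T -> X) (nu : nat -> T -> R) (g : nat -> R) (w : T) : \bar R :=
  ((`|orthogonal_proj (kernel_of A) (U w)| ^+ 2)%:E +
   \sum_(0 <= n <oo)
     (((1 - sigma n * g n) * <|U w, u n|> - g n * nu n w) ^+ 2)%:E)%E.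

Definition expected_error (R : realType) (X Y : hilbertType R)
    (A : {linear X -> Y}) (sigma : nat -> R) (u : nat -> X) d
    (T : measurableType d) (P : probability T R)
    (U : T -> X) (nu : nat -> T -> R) (g : nat -> R) : \bar R :=
  (\int[P]_w squared_error A sigma u U nu g w)%E.

Definition is_minimizer (R : realType) (G : Type) (J : G -> \bar R) (g : G) :=
  forall h, (J g <= J h)%E.

(* Main.v *)
Require Import Defs.
From mathcomp Require Import all_boot all_order all_algebra.
From mathcomp Require Import all_classical all_reals all_analysis.
From mathcomp Require Import measurable_realfun.
From mathcomp Require Import ring lra.
Import Order.TTheory GRing.Theory Num.Theory.
Import numFieldNormedType.Exports.
Local Open Scope classical_set_scope.
Local Open Scope ring_scope.

(** The expected error decouples into one scalar quadratic problem per singular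
    index. By Tonelli, expectation and sum commute in the squared error; in the
    [n]-th term the cross product of [<U, u_n>] and [<nu, v_n>] has zero mean by
    independence and centering, which leaves
      [(1 - sigma_n g_n)^2 Pi_n + g_n^2 Delta_n]
    ([expected_error_decomp]). Completing the square with
    [D_n = sigma_n^2 Pi_n + Delta_n > 0] turns this term into
      [Delta_n Pi_n / D_n + D_n (g_n - sigma_n Pi_n / D_n)^2]
    ([risk_complete_square]). The sum of the first parts is then the excess of
    the minimum over [E |U_0|^2], and the second parts vanish only at the
    claimed [g] ([separable_quadratic_min]).

    Uniqueness and the subtraction of [E |U_0|^2] need a finite minimum. It is
    bounded by the error at [g = 0], which is [E |U|^2] because
    [|x|^2 = |x_0|^2 + \sum_n <x, u_n>^2] where [x_0] is the projection of [x]
    on the kernel ([parseval]). The same identity exhibits [|x_0|^2] as a limit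
    of continuous functions of [x], hence as a measurable one. It rests on
    [x_0] being [x] minus the sum of its Fourier series: that series converges
    by Bessel and completeness, and the singular value expansion shows that [A]
    vanishes on the difference ([orthogonal_proj_kernel]). *)

(** * Inner products *)

Lemma innerC {R : realType} {H : hilbertType R} (x y : H) :
  <|x, y|> = <|y, x|>.
Proof. by rewrite hermC /= expr0 mul1r. Qed.

Lemma innerDl {R : realType} {H : hilbertType R} (x y z : H) :
  <|x + y, z|> = <|x, z|> + <|y, z|>.
Proof. by rewrite linearDl. Qed.

Lemma innerZl {R : realType} {H : hilbertType R} (a : R) (x y : H) :
  <|a *: x, y|> = a * <|x, y|>.
Proof. by rewrite linearZl_LR. Qed.

Lemma innerBl {R : realType} {H : hilbertType R} (x y z : H) :
  <|x - y, z|> = <|x, z|> - <|y, z|>.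
Proof. by rewrite linearBl. Qed.

Lemma inner_suml {R : realType} {H : hilbertType R} {I : Type} (s : seq I)
    (f : I -> H) (y : H) :
  <|\sum_(i <- s) f i, y|> = \sum_(i <- s) <|f i, y|>.
Proof. by rewrite linear_sumlz. Qed.

Lemma inner_polar {R : realType} {H : hilbertType R} (x y : H) :
  <|x, y|> = (`|x + y| ^+ 2 - `|x| ^+ 2 - `|y| ^+ 2) / 2.
Proof.
rewrite -!inner_norm !innerDl !(innerC _ (x + y)) !innerDl (innerC y x).
by field.
Qed.

Lemma sqr_normD {R : realType} {H : hilbertType R} (x y : H) :
  `|x + y| ^+ 2 = `|x| ^+ 2 + `|y| ^+ 2 + 2 * <|x, y|>.
Proof. by rewrite inner_polar; field. Qed.

(** By polarization, continuity of the norm suffices. *)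
Lemma inner_continuous {R : realType} {H : hilbertType R} (y : H) :
  continuous (fun x : H => <|x, y|>).
Proof.
move=> x; have sqrc (f : H -> H) : f z @[z --> x] --> f x ->
    `|f z| ^+ 2 @[z --> x] --> `|f x| ^+ 2.
  by move=> fx; rewrite expr2; apply: cvgM; exact: cvg_norm.
under eq_fun do rewrite inner_polar.
apply: cvgMl; apply: cvgB; last exact: cvg_cst.
apply: cvgB; last exact: sqrc.
by apply: (sqrc (+%R^~ y)); apply: cvgD => //; exact: cvg_cst.
Qed.

(** * Fourier series and the projection on the kernel *)

Lemma orthonormal_sum_norm {R : realType} {H : hilbertType R} (u : nat -> H)
    (c : nat -> R) (s : seq nat) :
  (forall m n, <|u m, u n|> = (m == n)%:R) -> uniq s ->
  `|\sum_(i <- s) c i *: u i| ^+ 2 = \sum_(i <- s) c i ^+ 2.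
Proof.
move=> uon; elim: s => [|k s IH]; first by rewrite !big_nil normr0 expr0n.
move=> /= /andP[ks us]; rewrite !big_cons -IH//.
set S := \sum_(i <- s) _.
have uS : <|S, u k|> = 0.
  rewrite inner_suml big1_seq//= => i si; rewrite innerZl uon.
  by case: eqVneq => [ik|]; [rewrite -ik si in ks | rewrite mulr0].
have uk : `|u k| ^+ 2 = 1 by rewrite -inner_norm uon eqxx.
rewrite sqr_normD normrZ exprMn uk real_normK ?num_real// innerZl.
by rewrite innerC uS !mulr0 mulr1 addr0.
Qed.

Lemma bessel_eq {R : realType} {H : hilbertType R} (u : nat -> H) (x : H) n :
  (forall m n, <|u m, u n|> = (m == n)%:R) ->
  `|x - series (fun i => <|x, u i|> *: u i) n| ^+ 2 =
  `|x| ^+ 2 - series (fun i => <|x, u i|> ^+ 2) n.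
Proof.
move=> uon; set S := series _ n; set s := series _ n.
have SS : <|S, S|> = s by rewrite inner_norm orthonormal_sum_norm ?iota_uniq.
have Sx : <|S, x|> = s.
  by rewrite inner_suml; apply: eq_bigr => i _; rewrite innerZl innerC expr2.
rewrite sqr_normD normrN -(inner_norm S) SS innerC -scaleN1r innerZl Sx.
by ring.
Qed.

(** The squared coefficients are summable by Bessel's inequality, and the
    squared norm of a block of the Fourier series is the corresponding block of
    squared coefficients, so the partial sums are Cauchy. *)
Lemma fourier_cvg {R : realType} {H : hilbertType R} (u : nat -> H) (x : H) :
  (forall m n, <|u m, u n|> = (m == n)%:R) ->
  cvgn (series (fun i => <|x, u i|> *: u i)).
Proof.
move=> uon.
have : cvgn (series (fun i => <|x, u i|> ^+ 2)).
  apply: nondecreasing_is_cvgn.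
    by apply: nondecreasing_series => *; exact: sqr_ge0.
  exists (`|x| ^+ 2) => _ [n _ <-].
  by rewrite -subr_ge0 -bessel_eq// sqr_ge0.
move=> /cauchy_cvgP/cauchy_seriesP cc; apply/cauchy_cvgP/cauchy_seriesP => e e0.
have := cc _ (exprn_gt0 2 e0); apply: filterS => -[m n]/=.
rewrite ger0_norm ?sumr_ge0// => [|*]; last exact: sqr_ge0.
rewrite -(orthonormal_sum_norm u) ?iota_uniq// ltr_pXn2r//.
all: by rewrite nnegrE// ltW.
Qed.

(** Two candidates for the projection differ by a vector that lies both in the
    kernel and in its orthogonal complement. *)
Lemma orthogonal_proj_eq {R : realType} {X Y : hilbertType R}
    (A : {linear X -> Y}) (x p : X) :
  kernel_of A p -> orthogonal_compl (kernel_of A) (x - p) ->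
  orthogonal_proj (kernel_of A) x = p.
Proof.
move=> Ap xp; apply: xget_unique; first by split.
move=> q [Aq xq]; apply/eqP; rewrite -subr_eq0 -normr_eq0 -sqrf_eq0.
have Apq : kernel_of A (q - p) by rewrite /kernel_of/= raddfB/= Ap Aq subr0.
rewrite -inner_norm [X in inner X](_ : q - p = (x - p) - (x - q)); last first.
  by rewrite opprB [RHS]addrC addrA subrK.
by rewrite innerBl xp// xq// subrr.
Qed.

(** All coefficients of the right-hand side on [u] vanish, so [A] maps it to 0
    by the singular value expansion; what is subtracted lies in the closed span
    of [u], which is the orthogonal complement of the kernel. *)
Lemma orthogonal_proj_kernel {R : realType} {X Y : hilbertType R}
    {A : {linear X -> Y}} {sigma : nat -> R} {u : nat -> X} {v : nat -> Y}
    (x : X) :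
  singular_system A sigma u v ->
  orthogonal_proj (kernel_of A) x =
  x - limn (series (fun i => <|x, u i|> *: u i)).
Proof.
case=> _ _ [uon uker] _ svd.
set S := series _; set L := limn S.
have SL : S @ \oo --> L by exact: fourier_cvg.
have Lu k : <|L, u k|> = <|x, u k|>.
  have h1 : <|S n, u k|> @[n --> \oo] --> <|L, u k|>.
    by have := inner_continuous (u k) L; exact: cvg_comp SL.
  have h2 : <|S n, u k|> @[n --> \oo] --> <|x, u k|>.
    apply: cvg_near_cst; exists k.+1 => // n /= kn.
    rewrite inner_suml (bigD1_seq k) ?mem_index_iota ?iota_uniq//=.
    rewrite innerZl uon eqxx mulr1 big1 ?addr0// => i /negPf ik.
    by rewrite innerZl uon ik mulr0.
  exact: (cvg_unique _ h1 h2).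
apply: orthogonal_proj_eq.
  have := svd (x - L); rewrite [X in X @ \oo](_ : _ = cst 0); last first.
    apply/funext => n; rewrite /series/= big1// => i _.
    by rewrite innerBl Lu subrr mulr0 scale0r.
  by move=> h; exact: (cvg_unique _ h (cvg_cst 0)).
rewrite opprB addrC subrK -uker.
apply: closed_cvg SL; first exact: closed_closure.
apply: nearW => n; apply: subset_closure.
by exists n, (fun i => <|x, u i|>); rewrite /S /series/= big_mkord.
Qed.

Lemma parseval {R : realType} {X Y : hilbertType R}
    {A : {linear X -> Y}} {sigma : nat -> R} {u : nat -> X} {v : nat -> Y}
    (x : X) :
  singular_system A sigma u v ->
  `|x| ^+ 2 - series (fun i => <|x, u i|> ^+ 2) n @[n --> \oo] -->
  `|orthogonal_proj (kernel_of A) x| ^+ 2.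
Proof.
move=> ss; have [_ _ [uon _] _ _] := ss.
under eq_fun do rewrite -bessel_eq//.
rewrite (orthogonal_proj_kernel _ ss).
have N : `|x - series (fun i => <|x, u i|> *: u i) n| @[n --> \oo] -->
    `|x - limn (series (fun i => <|x, u i|> *: u i))|.
  by apply: cvg_norm; apply: cvgB; [exact: cvg_cst|exact: fourier_cvg].
exact: (cvgM N N).
Qed.

(** * Measurability *)

Lemma continuous_borel_measurable {R : realType} {X : normedModType R}
    (f : X -> R) : continuous f -> measurable_fun setT (f : borel X -> R).
Proof.
move=> /continuousP cf.
apply: (measurability _ (RGenOpens.measurableE R)).
move=> _ [_ [a [b ->] <-]].
rewrite setTI; apply: sub_sigma_algebra; apply: cf; exact: interval_open.
Qed.

Lemma measurable_coef {R : realType} {X : hilbertType R} {d}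
    {T : measurableType d} {P : probability T R} (U : {RV P >-> borel X})
    (e : X) : measurable_fun setT (fun w => <|U w : X, e|>).
Proof.
have mi := continuous_borel_measurable _ (inner_continuous e).
exact: (measurableT_comp mi).
Qed.

(** Parseval's identity makes the squared norm of the projection a pointwise
    limit of measurable functions. *)
Lemma measurable_proj {R : realType} {X Y : hilbertType R}
    {A : {linear X -> Y}} {sigma : nat -> R} {u : nat -> X} {v : nat -> Y} {d}
    {T : measurableType d} {P : probability T R} (U : {RV P >-> borel X}) :
  singular_system A sigma u v ->
  measurable_fun setT
    (fun w => `|orthogonal_proj (kernel_of A) (U w : X)| ^+ 2).
Proof.
move=> ss; apply: measurable_fun_cvg (fun x _ => parseval _ ss) => n.
apply: measurable_funB.
  apply: measurable_funX.
  have mi := continuous_borel_measurable _ (@norm_continuous _ X).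
  exact: (measurableT_comp mi).
apply: measurable_sum => i; apply: measurable_funX; exact: measurable_coef.
Qed.

(** * Independent random variables with finite second moments *)

(** Independence says that the joint law agrees with the product of the two
    laws on rectangles, hence everywhere; Fubini then splits the integral of
    the product. *)
Lemma expectationM_indep {R : realType} {d} {T : measurableType d}
    {P : probability T R} (X Y : {RV P >-> R}) :
  (forall A B, measurable A -> measurable B ->
    P (X @^-1` A `&` Y @^-1` B) = (P (X @^-1` A) * P (Y @^-1` B))%E) ->
  P.-integrable setT (EFin \o X) -> P.-integrable setT (EFin \o Y) ->
  P.-integrable setT (fun w => (X w * Y w)%:E) ->
  ('E_P[fun w => (X w * Y w)%R] = 'E_P[X] * 'E_P[Y])%E.
Proof.
move=> indXY iX iY iXY; rewrite unlock.
pose Z w := (X w, Y w).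
have mZ : measurable_fun setT Z by exact: measurable_fun_pair.
pose mu1 := distribution P X; pose mu2 := distribution P Y.
pose f (z : R * R) : \bar R := (z.1 * z.2)%:E.
have mf : measurable_fun setT f.
  by apply/measurable_EFinP; exact: measurable_funM.
have jointE (B : set (R * R)) : measurable B ->
    (mu1 \x mu2)%E B = pushforward P Z B.
  by apply: product_measure_unique => A1 A2 mA1 mA2; rewrite -indXY.
transitivity (\int[pushforward P Z]_z f z)%E.
  by rewrite integral_pushforward.
transitivity (\int[mu1 \x mu2]_z f z)%E.
  by apply: eq_measure_integral => B mB _; exact: (esym (jointE B mB)).
have iZ : (pushforward P Z).-integrable setT f.
  by apply: integrable_pushforward.
have iprod : (mu1 \x mu2)%E.-integrable setT f.
  apply/integrableP; split=> //; case/integrableP: iZ => _.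
  rewrite (eq_measure_integral (mu1 \x mu2)%E)//.
  by move=> B mB _; exact: (esym (jointE B mB)).
have iX' : mu1.-integrable setT EFin by exact: integrable_pushforward.
have iY' : mu2.-integrable setT EFin by exact: integrable_pushforward.
have EX : (\int[mu1]_x x%:E = \int[P]_w (X w)%:E)%E.
  exact: integral_distribution.
have EY : (\int[mu2]_x x%:E = \int[P]_w (Y w)%:E)%E.
  exact: integral_distribution.
have finEY : (\int[mu2]_y y%:E)%E \is a fin_num by exact: integrable_fin_num.
rewrite -integral12_prod_meas1// -EX -EY -(fineK finEY) -integralZr//.
apply: eq_integral => x _; rewrite /fubini_F/f/=.
under eq_integral do rewrite EFinM.
by rewrite integralZl// fineK.
Qed.

Lemma sqr_integrable {R : realType} {d} {T : measurableType d}
    {P : probability T R} (X : {RV P >-> R}) (a : R) :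
  a%:E = second_moment P X -> P.-integrable setT (fun w => (X w ^+ 2)%:E).
Proof.
rewrite /second_moment unlock => aE; apply/integrableP; split.
  by apply/measurable_EFinP; exact: measurable_funX.
under eq_integral do rewrite gee0_abs ?lee_fin ?sqr_ge0//.
by rewrite -aE ltry.
Qed.

Lemma prod_integrable {R : realType} {d} {T : measurableType d}
    {P : probability T R} (X Y : {RV P >-> R}) (a b : R) :
  a%:E = second_moment P X -> b%:E = second_moment P Y ->
  P.-integrable setT (fun w => (X w * Y w)%:E).
Proof.
move=> /sqr_integrable iX /sqr_integrable iY.
apply: (le_integrable measurableT _ _ (integrableD measurableT iX iY)) => //.
  by apply/measurable_EFinP; exact: measurable_funM.
(* |x y| <= x^2 + y^2 *)
move=> w _ /=; rewrite lee_fin [leRHS]ger0_norm ?addr_ge0 ?sqr_ge0//.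
by rewrite ler_norml; apply/andP; split; nra.
Qed.

Lemma RV_integrable {R : realType} {d} {T : measurableType d}
    {P : probability T R} (X : {RV P >-> R}) (a : R) :
  a%:E = second_moment P X -> P.-integrable setT (EFin \o X).
Proof.
move=> /sqr_integrable iX.
have i1 : P.-integrable setT (EFin \o cst 1).
  exact: finite_measure_integrable_cst.
apply: (le_integrable measurableT _ _ (integrableD measurableT i1 iX)) => //.
  exact/measurable_EFinP.
(* |x| <= 1 + x^2 *)
move=> w _ /=; rewrite lee_fin [leRHS]ger0_norm ?addr_ge0 ?sqr_ge0//.
by rewrite ler_norml; apply/andP; split; nra.
Qed.

(** The cross term has expectation [- 2 s t E[X] E[Y] = 0]. *)
Lemma expectation_sqr_comb {R : realType} {d} {T : measurableType d}
    {P : probability T R} (X Y : {RV P >-> R}) (a b s t : R) :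
  (forall A B, measurable A -> measurable B ->
    P (X @^-1` A `&` Y @^-1` B) = (P (X @^-1` A) * P (Y @^-1` B))%E) ->
  ('E_P[Y] = 0)%E ->
  a%:E = second_moment P X -> b%:E = second_moment P Y ->
  (\int[P]_w ((s * X w - t * Y w) ^+ 2)%:E)%E = (s ^+ 2 * a + t ^+ 2 * b)%:E.
Proof.
move=> ind EY0 aE bE.
have iX2 := sqr_integrable _ _ aE; have iY2 := sqr_integrable _ _ bE.
have iXY := prod_integrable _ _ _ _ aE bE.
have := expectationM_indep _ _ ind (RV_integrable _ _ aE)
  (RV_integrable _ _ bE) iXY.
rewrite EY0 mule0; move: aE bE; rewrite /second_moment unlock => aE bE EXY.
rewrite (eq_integral (fun w => (s ^+ 2)%:E * (X w ^+ 2)%:E +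
    ((t ^+ 2)%:E * (Y w ^+ 2)%:E +
     (- (2 * s * t))%:E * (X w * Y w)%:E)))%E; last first.
  by move=> w _; rewrite -!EFinM -!EFinD; congr EFin; ring.
rewrite integralD// ?integralD//; last 4 first.
all: try by exact: integrableZl.
  by apply: integrableD => //; exact: integrableZl.
by rewrite !integralZl// -aE -bE EXY mule0 adde0 -!EFinM -EFinD.
Qed.

(** * Decoupling and minimization of the expected error *)

Lemma expected_error_decomp {R : realType} {X Y : hilbertType R}
    {A : {linear X -> Y}} {sigma : nat -> R} {u : nat -> X} {v : nat -> Y}
    {d} {T : measurableType d} {P : probability T R}
    {U : {RV P >-> borel X}} {nu : nat -> {RV P >-> R}}
    {Pi Delta : nat -> R} (g : nat -> R) :
  singular_system A sigma u v ->
  independent_systems P (sigma_gen U) (sigma_gen_seq nu) ->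
  (forall n, 'E_P[nu n] = 0)%E ->
  (forall n, (Pi n)%:E = second_moment P (fun w => <|U w : X, u n|>)) ->
  (forall n, (Delta n)%:E = second_moment P (nu n)) ->
  (expected_error A sigma u P U nu g =
   second_moment P (fun w => `|orthogonal_proj (kernel_of A) (U w)|%R) +
   \sum_(0 <= n <oo)
     ((1 - sigma n * g n) ^+ 2 * Pi n + g n ^+ 2 * Delta n)%R%:E)%E.
Proof.
move=> ss ind nu0 PiE DeltaE; rewrite /expected_error /squared_error.
have mcoef n := measurable_coef U (u n).
have mterm n : measurable_fun setT (fun w =>
    (((1 - sigma n * g n) * <|U w : X, u n|> - g n * nu n w) ^+ 2)%:E).
  apply/measurable_EFinP; apply: measurable_funX.
  by apply: measurable_funB; exact: measurable_funM.
have term0 n w : (0 <=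
    (((1 - sigma n * g n) * <|U w : X, u n|> - g n * nu n w) ^+ 2)%:E)%E.
  by rewrite lee_fin sqr_ge0.
rewrite ge0_integralD//; last 3 first.
- by apply/measurable_EFinP; exact: measurable_proj ss.
- by move=> w _; exact: nneseries_ge0.
- exact: ge0_emeasurable_sum.
rewrite /second_moment [in RHS]unlock; congr (_ + _)%E.
rewrite integral_nneseries//; apply: eq_eseriesr => n _.
pose Z : {RV P >-> R} := mfun_Sub (mem_set (mcoef n)).
apply: (expectation_sqr_comb Z (nu n)) => //.
  move=> B1 B2 mB1 mB2; apply: ind.
    have mi := continuous_borel_measurable _ (inner_continuous (u n)).
    exists ((fun x : X => <|x, u n|>) @^-1` B1); last by rewrite setTI.
    by rewrite -[X in measurable X]setTI; exact: mi.
  apply: sub_sigma_algebra; exists n => //.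
  by exists B2 => //; rewrite setTI.
Qed.

Lemma risk_complete_square {R : realType} (sigma Pi Delta g : R) :
  0 < sigma ^+ 2 * Pi + Delta ->
  (1 - sigma * g) ^+ 2 * Pi + g ^+ 2 * Delta =
  Delta * Pi / (sigma ^+ 2 * Pi + Delta) +
  (sigma ^+ 2 * Pi + Delta) *
    (g - sigma * Pi / (sigma ^+ 2 * Pi + Delta)) ^+ 2.
Proof. by move=> D0; field; rewrite gt_eqF. Qed.

(** The finite value at one [g] makes the value at [gb] finite, so both can be
    cancelled: a minimizer has a vanishing sum of nonnegative deviations. *)
Lemma separable_quadratic_min {R : realType} (C : \bar R) (m D gb : nat -> R)
    (J : (nat -> R) -> \bar R) :
  (0 <= C)%E -> (forall n, 0 <= m n) -> (forall n, 0 < D n) ->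
  (forall g, J g =
    (C + \sum_(0 <= n <oo) (m n + D n * (g n - gb n) ^+ 2)%:E)%E) ->
  (exists g, (J g < +oo)%E) ->
  (forall g, is_minimizer J g <-> g = gb) /\
  (ereal_inf (range J) - C = \sum_(0 <= n <oo) (m n)%:E)%E.
Proof.
move=> C0 m0 D0 JE [g0 g0oo].
have Q0 g n : (0 <= (D n * (g n - gb n) ^+ 2)%:E)%E.
  by rewrite lee_fin mulr_ge0 ?sqr_ge0// ltW.
have m0' n : (0 <= (m n)%:E)%E by rewrite lee_fin.
set S := (\sum_(0 <= n <oo) (m n)%:E)%E.
pose Q g := (\sum_(0 <= n <oo) (D n * (g n - gb n) ^+ 2)%:E)%E.
have S0 : (0 <= S)%E by exact: nneseries_ge0.
have Qge0 g : (0 <= Q g)%E by exact: nneseries_ge0.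
have {}JE g : J g = (C + S + Q g)%E.
  by rewrite JE -addeA; congr (_ + _)%E; rewrite -nneseriesD.
have Jgb : J gb = (C + S)%E.
  rewrite JE [Q _](_ : _ = 0%E) ?adde0// /Q eseries0// => n _ _.
  by rewrite subrr expr0n mulr0.
have gbmin : is_minimizer J gb by move=> g; rewrite Jgb JE leeDl.
have CSoo : (C + S < +oo)%E by rewrite -Jgb; exact: le_lt_trans (gbmin g0) g0oo.
have CSfin : (C + S)%E \is a fin_num by rewrite ge0_fin_numE// adde_ge0.
have Cfin : C \is a fin_num.
  by rewrite ge0_fin_numE//; apply: le_lt_trans CSoo; rewrite leeDl.
split; last first.
  have -> : ereal_inf (range J) = J gb.
    apply/eqP; rewrite eq_le; apply/andP; split.
      by apply: ereal_inf_lbound; exists gb.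
    by apply: le_ereal_inf_tmp => _ [g _ <-]; exact: gbmin.
  by rewrite Jgb addeAC subee// add0e.
move=> g; split=> [gmin|->//].
have := gmin gb; rewrite Jgb JE -[leRHS]adde0 leeD2lE// => Qle0.
apply/funext => n; apply/eqP; rewrite -subr_eq0 -sqrf_eq0.
have : ((D n * (g n - gb n) ^+ 2)%:E <= 0)%E.
  apply: le_trans Qle0; rewrite /Q (nneseriesD1 (n:=n))//.
  by rewrite leeDl// nneseries_ge0.
rewrite lee_fin pmulr_rle0// => h.
by rewrite eq_le h sqr_ge0.
Qed.

Lemma nneseries_EFin {R : realType} (f : nat -> R) (r : R) :
  series f n @[n --> \oo] --> r -> (\sum_(0 <= n <oo) (f n)%:E = r%:E)%E.
Proof.
move=> fr; apply: cvg_lim => //.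
under eq_fun do rewrite sumEFin.
by apply: cvg_EFin fr; exact: nearW.
Qed.

Theorem mainTheorem1 (R : realType) (X Y : hilbertType R)
  (A : {linear X -> Y}) (sigma : nat -> R) (u : nat -> X) (v : nat -> Y)
  (d : measure_display) (T : measurableType d) (P : probability T R)
  (U : {RV P >-> borel X}) (nu : nat -> {RV P >-> R})
  (Pi Delta : nat -> R) :
  infinite_dimensional [set: X] ->
  infinite_dimensional [set: Y] ->
  compact_operator A ->
  infinite_dimensional (range A) ->
  singular_system A sigma u v ->
  (second_moment P (fun w => `|U w : X|%R) < +oo)%E ->
  independent_systems P (sigma_gen U) (sigma_gen_seq nu) ->
  (forall n, 'E_P[nu n] = 0)%E ->
  (forall n, (Pi n)%:E = second_moment P (fun w => <|U w : X, u n|>)) ->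
  (forall n, (Delta n)%:E = second_moment P (nu n)) ->
  has_ubound (range Delta) ->
  (forall n, 0 < Pi n \/ 0 < Delta n) ->
  let J := expected_error A sigma u P U nu in
  (forall g : nat -> R, is_minimizer J g <->
    g = (fun n => sigma n * Pi n / (sigma n ^+ 2 * Pi n + Delta n))) /\
  (ereal_inf (range J) -
     second_moment P (fun w => `|orthogonal_proj (kernel_of A) (U w)|%R) =
   \sum_(0 <= n <oo)
     ((Delta n * Pi n / (sigma n ^+ 2 * Pi n + Delta n))%R)%:E)%E.
Proof.
move=> _ _ _ _ ss U2 ind nu0 PiE DeltaE _ pos J.
have second_moment_ge0 (Z : T -> R) : (0 <= second_moment P Z)%E.
  by apply: expectation_ge0 => w; exact: sqr_ge0.
have Pi0 n : 0 <= Pi n by rewrite -lee_fin PiE.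
have Delta0 n : 0 <= Delta n by rewrite -lee_fin DeltaE.
have sigma0 n : 0 < sigma n by case: ss.
have D0 n : 0 < sigma n ^+ 2 * Pi n + Delta n.
  have [Pin|Dn] := pos n.
    by rewrite ltr_wpDr// mulr_gt0// exprn_gt0.
  by rewrite ltr_wpDl// mulr_ge0// ltW// exprn_gt0.
apply: (separable_quadratic_min _ _
  (fun n => sigma n ^+ 2 * Pi n + Delta n)) => //.
- by move=> n; rewrite divr_ge0 ?mulr_ge0// ltW.
- move=> g; rewrite /J (expected_error_decomp _ ss ind nu0 PiE DeltaE).
  congr (_ + _)%E; apply: eq_eseriesr => n _.
  by rewrite -risk_complete_square.
(* At g = 0 the squared error is |U|^2 by Parseval's identity. *)
exists (fun=> 0); apply: le_lt_trans U2.
rewrite /J /expected_error /second_moment unlock le_eqVlt.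
apply/orP; left; apply/eqP.
apply: eq_integral => w _; rewrite /squared_error.
under eq_eseriesr do rewrite mulr0 subr0 mul1r mul0r subr0.
rewrite (nneseries_EFin _ (`|U w : X| ^+ 2 -
    `|orthogonal_proj (kernel_of A) (U w : X)| ^+ 2)).
  by rewrite -EFinD addrC subrK.
have h := cvgB (cvg_cst (`|U w : X| ^+ 2)) (parseval (U w) ss).
under eq_fun do rewrite -[series _ _](subKr (`|U w : X| ^+ 2)).
exact: h.
Qed.
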